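(* Let $\Lambda\subset\mathbb{Z}^d$ be finite and nonempty, and consider the CBTW model with $a=b\in[0,1)$, where $a\notin\{\frac{l}{2d}: l=0,1,\dots,2d-1\}$. Then for every initial configuration $\eta\in\Omega=[0,1)^\Lambda$, the distribution of the process at time $t$ does not converge weakly (to any probability measure) as $t\to\infty$.
   Context: Let $d\ge 1$ and let $\Lambda\subset\mathbb{Z}^d$ be finite and nonempty. Put $\mathcal{X}=[0,\infty)^\Lambda$ (configurations) and $\Omega=[0,1)^\Lambda$ (stable configurations). Let $\Delta$ be the $|\Lambda|\times|\Lambda|$ matrix with $\Delta(x,x)=1$, $\Delta(x,y)=-\frac1{2d}$ if $|x-y|=1$ (Euclidean norm), and $\Delta(x,y)=0$ otherwise. The toppling operator at $x$ is $T_x\eta=\eta-\Delta(x,\cdot)$; it is legal on $\eta$ if $\eta(x)\ge 1$. It is a known fact that from every $\eta\in\mathcal{X}$, performing legal topplings leads after finitely many steps to a stable configuration, which does not depend on the order of the legal topplings; it is denoted $\mathcal{S}\eta\in\Omega$ (stabilization). With $\delta_x$ the indicator configuration of site $x$, the addition operator is $A_x^u\eta=\mathcal{S}(\eta+u\delta_x)$ for $u\ge 0$. The CBTW sandpile model with $a=b$ is the Markov chain $\eta_t=A_{X_t}^{a}\eta_{t-1}$, $t=1,2,\dots$, on $\Omega$, where $X_1,X_2,\dots$ are i.i.d. uniform on $\Lambda$ and $\eta_0=\eta$ is the initial configuration. *)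

(* Defs.v *)
From HB Require Import structures.
From mathcomp Require Import all_boot all_order all_algebra finmap.
From mathcomp Require Import all_classical all_reals all_analysis.

Set Implicit Arguments.
Unset Strict Implicit.
Unset Printing Implicit Defensive.

Import Order.TTheory GRing.Theory Num.Theory.
Import numFieldNormedType.Exports.

Local Open Scope classical_set_scope.
Local Open Scope ring_scope.

Section Sandpile.
Context {R : realType} {d : nat} {L : {fset 'rV[int]_d}}.

Definition euclidean_dist (x y : 'rV[int]_d) : R :=
  Num.sqrt (\sum_(i < d) ((x 0 i - y 0 i)%:~R : R) ^+ 2).

Definition Delta (x y : L) : R :=
  if x == y then 1
  else if euclidean_dist (val x) (val y) == 1 then - (2 * d)%:R^-1
  else 0.

(* The topology of pointwise convergence, i.e. that of R^L as L is finite. *)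
Definition config : Type := {ptws L -> R}.
HB.instance Definition _ := Topological.copy config {ptws L -> R}.

(* As a type, [stable] carries the subspace topology. *)
Definition stable : set config := [set eta | forall x, 0 <= eta x < 1].

Lemma stable0 : stable (fun=> 0).
Proof. by move=> x; rewrite lexx ltr01. Qed.

HB.instance Definition _ :=
  isPointed.Build (set_type stable) (SigSub (mem_set stable0)).

Definition topple (x : L) (eta : config) : config :=
  fun y => eta y - Delta x y.

Inductive legal_topplings (eta : config) : config -> Prop :=
| legal_refl : legal_topplings eta eta
| legal_step (x : L) (xi : config) :
    1 <= eta x -> legal_topplings (topple x eta) xi -> legal_topplings eta xi.

(* From every nonnegative configuration, exactly one stable configuration is
   reachable by legal topplings; [xget] selects it, so that its default value
   [point] plays no role there. *)
Definition stabilize (eta : config) : set_type stable :=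
  xget point [set xi : set_type stable | legal_topplings eta (set_val xi)].

Definition addition (x : L) (u : R) (eta : config) : set_type stable :=
  stabilize (fun y => eta y + u * (y == x)%:R).

(* The term [X t] is the site of the (t+1)-st addition. *)
Fixpoint process (a : R) (eta : set_type stable) (T : Type)
    (X : nat -> T -> L) (t : nat) (w : T) : set_type stable :=
  match t with
  | 0%N => eta
  | s.+1 => addition (X s w) a (set_val (process a eta X s w))
  end.

End Sandpile.

Arguments config : clear implicits.
Arguments stable : clear implicits.

Section Probability.
Local Open Scope ereal_scope.

Definition iid_uniform (R : realType) (dT : measure_display)
    (T : measurableType dT) (P : probability T R) (E : finType)
    (X : nat -> T -> E) : Prop :=
  [/\ (forall t (A : set E), measurable (X t @^-1` A)),
      (forall t (x : E), P (X t @^-1` [set x]) = (#|E|%:R^-1)%:E)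
    & (forall (I : {fset nat}) (A : nat -> set E),
        P (\bigcap_(t in [set` I]) (X t @^-1` A t))
        = \prod_(t <- I) P (X t @^-1` A t))].

Definition borel (S : ptopologicalType) := g_sigma_algebraType (@open S).

Definition weakly_converges (R : realType) (S : ptopologicalType)
    (m : nat -> set (borel S) -> \bar R) (mu : probability (borel S) R) :=
  forall f : S -> R, continuous f -> bounded_fun f ->
    (fun n => \int[m n]_(s in [set: borel S]) (f s)%:E) @ \oo
      --> \int[mu]_(s in [set: borel S]) (f s)%:E.

Definition law (R : realType) (d : nat) (L : {fset 'rV[int]_d})
    (dT : measure_display) (T : measurableType dT) (P : probability T R)
    (a : R) (eta : set_type (stable R d L)) (X : nat -> T -> L) (t : nat) :
    set (borel (set_type (stable R d L))) -> \bar R :=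
  pushforward P
    (process a eta X t : T -> borel (set_type (stable R d L))).

End Probability.

(* Main.v *)
(** The test functions [cos (2 pi phase)] and [sin (2 pi phase)], where [phase]
    is 2d times the total mass, do not see topplings: 2d times a row sum of
    [Delta] is an integer.  Each addition shifts [phase] by 2da, so both
    functions are deterministic along the process and rotate at the constant
    angle 2 pi (2da).  A weak limit would make the rotation converge, which
    forces 2da to be an integer, i.e. a = l/(2d).
    Stabilization terminates because a nonnegative strictly superharmonic weight
    of the configuration drops by a fixed amount at every toppling. *)

Require Import Defs.
From HB Require Import structures.
From mathcomp Require Import all_boot all_order all_algebra finmap.
From mathcomp Require Import all_classical all_reals all_analysis.
From mathcomp Require Import measurable_realfun ring lra.

Import Order.TTheory GRing.Theory Num.Theory.
Import numFieldNormedType.Exports.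

Local Open Scope classical_set_scope.
Local Open Scope ring_scope.

(** * Termination of legal topplings *)

Definition unit_step {d : nat} (p : 'I_d * bool) : 'rV[int]_d :=
  (-1) ^+ p.2 *: delta_mx 0 p.1.

Section Stabilization.
Context {R : realType} {d : nat} {L : {fset 'rV[int]_d}}.
Hypothesis d_gt0 : (0 < d)%N.

(** A sum of integer squares equals 1 only if one term is 1 and all the others vanish. *)
Lemma euclidean_dist_eq1 (x y : 'rV[int]_d) :
  euclidean_dist x y = 1 :> R -> exists p, y = x + unit_step p.
Proof.
rewrite /euclidean_dist => dist1.
pose u i : int := y 0 i - x 0 i.
have sum_u2 : \sum_(i < d) u i ^+ 2 = 1.
  apply/eqP; rewrite -(eqr_int R) rmorph_sum -[eqbRHS](expr1n _ 2).
  rewrite -[X in _ == X ^+ _]dist1 sqr_sqrtr ?sumr_ge0 // => [|i _]; last first.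
    exact: sqr_ge0.
  apply/eqP/eq_bigr => i _.
  by rewrite /u rmorphXn /= -opprB rmorphN sqrrN.
have [i ui_neq0] : exists i, u i != 0.
  apply/existsP; apply: contra_eqT sum_u2 => /existsPn u0.
  by rewrite big1 // => i _; have := u0 i; rewrite negbK => /eqP ->.
have rest_ge0 : 0 <= \sum_(j < d | j != i) u j ^+ 2.
  by rewrite sumr_ge0 // => j _; exact: sqr_ge0.
have ui2_ge1 : 1 <= u i ^+ 2.
  by rewrite -gtz0_ge1 exprn_even_gt0.
rewrite (bigD1 i) //= in sum_u2.
have rest0 : \sum_(j < d | j != i) u j ^+ 2 == 0.
  by rewrite eq_le rest_ge0 andbT; lra.
have ui2 : u i ^+ 2 = 1 by move: sum_u2; rewrite (eqP rest0) addr0.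
move: rest0; rewrite psumr_eq0 => [/allP /= rest0|j _]; last exact: sqr_ge0.
exists (i, u i == -1); apply/rowP => j.
rewrite !mxE -[LHS](subrK (x 0 j)) -/(u j) addrC /=; congr (_ + _).
have [->|j_neq_i] := eqVneq j i; last first.
  have := rest0 j; rewrite mem_index_enum j_neq_i sqrf_eq0 => /(_ isT)/eqP ->.
  by rewrite mulr0.
by move/eqP: ui2; rewrite sqrf_eq1 => /orP[]/eqP ->; rewrite mulr1.
Qed.

(** Distinct neighbours of [x] in [L] are reached by distinct steps, so the left side is a subsum of
    the right one, and the leftover terms are nonnegative. *)
Lemma neighbour_sum_le (x : L) (g : 'rV[int]_d -> R) :
  (forall p, 0 <= g (val x + unit_step p)) ->
  \sum_(y : L | euclidean_dist (val x) (val y) == 1 :> R) g (val y) <=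
  \sum_p g (val x + unit_step p).
Proof.
move=> g_ge0.
have /choice[s sE] : forall y : L, exists p,
    euclidean_dist (val x) (val y) == 1 :> R -> val y = val x + unit_step p.
  move=> y; have [/eqP/euclidean_dist_eq1[p yE]|_] := boolP (_ == 1).
    by exists p.
  (* A dummy step for sites that are not neighbours of [x]. *)
  by exists (Ordinal d_gt0, true).
pose N := [set y : L | euclidean_dist (val x) (val y) == 1 :> R]%SET.
have s_inj : {in N &, injective s}.
  move=> y z; rewrite !inE => xy xz syz.
  by apply: val_inj; rewrite (sE _ xy) (sE _ xz) syz.
rewrite (eq_bigr (fun y => g (val x + unit_step (s y)))); last first.
  by move=> y xy; rewrite {1}(sE _ xy).
rewrite (eq_bigl (fun y => y \in N)) => [|y]; last by rewrite inE.
rewrite -(big_imset (fun p => g (val x + unit_step p))) //=.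
rewrite [leRHS](bigID (fun p => p \in (s @: N)%SET)) /= lerDl.
by apply: sumr_ge0 => p _; exact: g_ge0.
Qed.

(** Only the two steps along axis [i] change the summand, and
    [(m + 1)^2 + (m - 1)^2 = 2 * m^2 + 2]. *)
Lemma sum_step_parabola (c : R) (i : 'I_d) (x : 'rV[int]_d) :
  \sum_p (c - ((x + unit_step p) 0 i)%:~R ^+ 2) =
  (2 * d)%:R * (c - (x 0 i)%:~R ^+ 2) - 2.
Proof.
have -> : \sum_p (c - ((x + unit_step p) 0 i)%:~R ^+ 2) =
    \sum_(k < d) (2 * (c - (x 0 i)%:~R ^+ 2) - 2 * (k == i)%:R).
  rewrite -(pair_bigA _ (fun k b =>
    c - ((x + unit_step (k, b)) 0 i)%:~R ^+ 2)) /=.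
  apply: eq_bigr => k _; rewrite big_bool /= !mxE /= eq_sym.
  by case: (k == i); rewrite /= !rmorphD !rmorphM /=; ring.
rewrite sumrB sumr_const card_ord -mulr_sumr (bigD1 i) //= eqxx big1.
  by rewrite addr0 mulr1 -mulr_natr natrM; ring.
by move=> k /negbTE ->.
Qed.

(* [2 * d] times the lattice Laplacian of [z |-> (z 0 i) ^+ 2] is the constant
   2, and cutting the lattice down to [L] only removes nonnegative terms. *)
Lemma superharmonic_weight : exists h : L -> R,
  (forall x, 0 <= h x) /\ (forall x, d%:R^-1 <= \sum_y Delta x y * h y).
Proof.
pose i := Ordinal d_gt0.
(* A crude bound: the summand at [x] alone dominates the squared [i]-th coordinate at [x] and at all
   its lattice neighbours, so [g] is nonnegative on [L] and one step around it. *)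
pose c : R := \sum_(x : L) (`|val x 0 i|%:~R + 1) ^+ 2.
pose g (z : 'rV[int]_d) : R := c - (z 0 i)%:~R ^+ 2.
have g_ge0 (x : L) (e : int) :
    `|e| <= 1 -> ((val x 0 i + e)%:~R : R) ^+ 2 <= c.
  move=> e1; apply: (@le_trans _ _ ((`|val x 0 i|%:~R + 1) ^+ 2)).
    rewrite -real_normK ?num_real // ler_sqr ?nnegrE ?addr_ge0 ?ler0z //.
    rewrite -intr_norm -[1]/(1%:~R) -rmorphD ler_int.
    by rewrite (le_trans (ler_normD _ _)) // lerD2l.
  by rewrite /c (bigD1 x) //= lerDl sumr_ge0 // => y _; exact: sqr_ge0.
have d2_gt0 : 0 < (2 * d)%:R :> R by rewrite ltr0n muln_gt0.
exists (fun x => g (val x)); split => x.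
  by rewrite subr_ge0; have := g_ge0 x 0; rewrite addr0; apply; rewrite normr0.
have -> : \sum_y Delta x y * g (val y) = g (val x) - (2 * d)%:R^-1 *
    \sum_(y : L | euclidean_dist (val x) (val y) == 1 :> R) g (val y).
  rewrite (bigD1 x) //= {1}/Delta eqxx mul1r; congr (_ + _).
  rewrite mulr_sumr -sumrN [RHS]big_mkcond [LHS]big_mkcond /=.
  apply: eq_bigr => y _; rewrite /Delta eq_sym.
  have [<-|_] /= := eqVneq x y; last by case: ifP; rewrite ?mul0r ?mulNr.
  (* The site [x] is not its own neighbour, so the right side has no diagonal term either. *)
  rewrite /euclidean_dist big1 ?sqrtr0 => [|k _]; last by rewrite subrr expr0n.
  by rewrite eq_sym oner_eq0.
have S_le : (2 * d)%:R^-1 *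
    \sum_(y : L | euclidean_dist (val x) (val y) == 1 :> R) g (val y) <=
    g (val x) - (2 * d)%:R^-1 * 2.
  rewrite ler_pdivrMl // mulrBr mulVKf ?gt_eqF // -sum_step_parabola.
  apply: neighbour_sum_le => -[k b].
  rewrite subr_ge0 mxE; apply: g_ge0.
  rewrite !mxE normrM normrX normrN1 expr1n mul1r /=.
  by case: eqP; rewrite ?normr1 ?normr0.
have -> : d%:R^-1 = (2 * d)%:R^-1 * 2 :> R.
  by rewrite natrM invfM mulrAC mulVf ?mul1r // pnatr_eq0.
lra.
Qed.

Lemma legal_topplings_exist {eta : config R d L} :
  (forall x, 0 <= eta x) ->
  exists2 xi, legal_topplings eta xi & stable R d L xi.
Proof.
have [h [h_ge0 h_super]] := superharmonic_weight.
have d1_gt0 : 0 < d%:R^-1 :> R by rewrite invr_gt0 ltr0n.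
pose weight (xi : config R d L) := \sum_y xi y * h y.
(* Each toppling lowers [weight] by at least [1/d], which drives the induction on [n]; at [n = 0]
   the strict bound contradicts [weight] being nonnegative. *)
suff H n : forall xi : config R d L, (forall x, 0 <= xi x) ->
    weight xi < n%:R * d%:R^-1 ->
    exists2 zeta, legal_topplings xi zeta & stable R d L zeta.
  move=> eta_ge0; apply: (H (Num.truncn (weight eta * d%:R)).+1) => //.
  by rewrite ltr_pdivlMr ?ltr0n // truncnS_gt.
elim: n => [xi xi_ge0|n IHn xi xi_ge0 xi_lt].
  by rewrite mul0r ltNge sumr_ge0 // => y _; rewrite mulr_ge0.
have [xi_stable|] := pselect (stable R d L xi).
  by exists xi => //; exact: legal_refl.
move=> /existsNP[x /negP]; rewrite xi_ge0 /= -leNgt => xix_ge1.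
have [y||zeta top_zeta zeta_stable] := IHn (topple x xi).
(* The toppled site held at least 1, and off-diagonal entries of [Delta] are nonpositive. *)
- rewrite /topple subr_ge0 /Delta; case: eqP => [<- //|_].
  by case: ifP => // _; rewrite (le_trans _ (xi_ge0 y)) // oppr_le0 invr_ge0.
- rewrite /weight (eq_bigr (fun y => xi y * h y - Delta x y * h y)); last first.
    by move=> y _; rewrite -mulrBl.
  move: xi_lt; rewrite sumrB -/(weight xi) -natr1 mulrDl mul1r.
  by have := h_super x; lra.
by exists zeta => //; exact: legal_step top_zeta.
Qed.

(** Since a stable configuration is reachable, [xget] does not fall back on its default [point]. *)
Lemma stabilize_legal {eta : config R d L} :
  (forall x, 0 <= eta x) -> legal_topplings eta (set_val (stabilize eta)).
Proof.
move=> /legal_topplings_exist[xi eta_xi xi_stable].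
apply: (xgetPex point (P := [set xi | legal_topplings eta (set_val xi)])).
by exists (SigSub (mem_set xi_stable)).
Qed.

End Stabilization.

(** * Integer periods of cosine and sine in units of a full turn *)

Lemma cos_sin_intD {R : realType} {x y : R} : x - y \is a Num.int ->
  cos (pi *+ 2 * x) = cos (pi *+ 2 * y) /\
  sin (pi *+ 2 * x) = sin (pi *+ 2 * y).
Proof.
suff H (n : nat) (u v : R) : u - v = n%:R ->
    cos (pi *+ 2 * u) = cos (pi *+ 2 * v) /\
    sin (pi *+ 2 * u) = sin (pi *+ 2 * v).
  move=> /intrP[[n|n] xy]; first exact: (H n).
  (* A negative difference becomes positive when [x] and [y] are exchanged. *)
  by have [|-> ->] := H n.+1 y x => //; rewrite -opprB xy NegzE rmorphN opprK.
move=> /(canRL (subrK v)) ->; rewrite addrC mulrDr mulr_natr.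
by rewrite (periodicn (@cosD2pi R)) (periodicn (@sinD2pi R)).
Qed.

(** For the fractional part [r] of [x], [cos (2 pi r) = 1 - 2 sin (pi r)^2], and [sin (pi r)] is
    positive when [0 < r < 1]. *)
Lemma cos2pi_eq1 {R : realType} {x : R} :
  0 <= x -> cos (pi *+ 2 * x) = 1 -> x = (Num.truncn x)%:R.
Proof.
move=> x_ge0; have /andP[tr_le tr_gt] := truncn_itv x_ge0.
pose r := x - (Num.truncn x)%:R.
have [|-> _] := @cos_sin_intD _ x r; first by rewrite /r opprB addrC subrK.
have [r_gt0|r_le0 _] := ltP 0 r; last first.
  by apply/eqP; rewrite eq_le tr_le -subr_le0 r_le0.
have sin_gt0 : 0 < sin (pi * r).
  apply: sin_gt0_pi; rewrite mulr_gt0 ?pi_gt0 //= gtr_pMr ?pi_gt0 //.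
  by rewrite /r ltrBlDl natr1.
rewrite mulrnAl cos_mulr2n cos2sin2 => cos1.
have : 0 < sin (pi * r) ^+ 2 by rewrite exprn_gt0.
lra.
Qed.

(** * The phase along the process *)

Section Phase.
Context {R : realType} {d : nat} {L : {fset 'rV[int]_d}}.
Hypothesis d_gt0 : (0 < d)%N.

Definition phase (eta : config R d L) : R := (2 * d)%:R * \sum_x eta x.

Lemma phase_topple (x : L) (eta : config R d L) :
  phase (topple x eta) - phase eta \is a Num.int.
Proof.
rewrite /phase /topple sumrB -mulrBr addrC addKr mulrN rpredN mulr_sumr.
apply: rpred_sum => y _; rewrite /Delta.
case: ifP => _; first by rewrite mulr1 rpred_nat.
case: ifP => _; last by rewrite mulr0 rpred0.
by rewrite mulrN rpredN divff ?rpred1 // pnatr_eq0 -lt0n muln_gt0.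
Qed.

Lemma phase_legal_topplings {eta xi : config R d L} :
  legal_topplings eta xi -> phase xi - phase eta \is a Num.int.
Proof.
elim=> [zeta|zeta x {}xi _ _ IH]; first by rewrite subrr rpred0.
by rewrite -(subrKA (phase (topple x zeta))) rpredD // phase_topple.
Qed.

Lemma phase_process (a : R) (eta : set_type (stable R d L)) (T : Type)
    (X : nat -> T -> L) (t : nat) (w : T) : 0 <= a ->
  phase (set_val (process a eta X t w)) -
    (phase (set_val eta) + (2 * d)%:R * a * t%:R) \is a Num.int.
Proof.
move=> a_ge0; elim: t => [|t IHt] /=; first by rewrite mulr0 addr0 subrr rpred0.
rewrite /addition; set s := process _ _ _ _ _ in IHt *.
(* The configuration after the addition and before stabilization. *)
set xi : config R d L := fun y => _.
have xi_ge0 y : 0 <= xi y.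
  rewrite addr_ge0 ?mulr_ge0 //.
  by have /set_mem /= /(_ y)/andP[] := valP s.
have := phase_legal_topplings (stabilize_legal d_gt0 xi_ge0).
have -> : phase xi = phase (set_val s) + (2 * d)%:R * a.
  rewrite /phase /xi big_split /= -mulr_sumr mulrDr; congr (_ + _ * _).
  rewrite (bigD1 (X t w)) //= eqxx big1 ?addr0 ?mulr1 // => y.
  by move=> /negbTE ->.
move=> /rpredD/(_ IHt); congr (_ \is a Num.int).
by rewrite -natr1 mulrDr mulr1; ring.
Qed.

Lemma continuous_phase :
  continuous (fun s : set_type (stable R d L) => phase (set_val s)).
Proof.
move=> s; apply: (@cvgM _ _ (nbhs s) (nbhs_filter s) (cst _)).
  exact: cvg_cst.
apply: (@cvg_big R L +%R 0 xpredT) => [|x _]; first exact: add_continuous.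
apply: (@continuous_comp _ _ _ set_val (fun xi : config R d L => xi x)).
  exact: (@initial_continuous (set_type (stable R d L)) _ set_val).
exact: (@proj_continuous L (fun=> R) x).
Qed.

(** Splitting over the finitely many values of [X t] turns the event at time [t.+1] into one at time
    [t], for the preimage of [A] under a fixed addition. Taking [A] arbitrary lets the induction
    absorb that preimage without any regularity of [addition]. *)
Lemma measurable_process (a : R) (eta : set_type (stable R d L))
    (dT : measure_display) (T : measurableType dT) (X : nat -> T -> L)
    (t : nat) (A : set (set_type (stable R d L))) :
  (forall t (B : set L), measurable (X t @^-1` B)) ->
  measurable (process a eta X t @^-1` A).
Proof.
move=> mX; elim: t A => [|t IHt] A /=.
  rewrite -[X in measurable X]/((fun=> eta) @^-1` A) preimage_cst.
  by case: ifP.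
rewrite [X in measurable X](_ : _ = \bigcup_(x in [set: L])
  (X t @^-1` [set x] `&`
   process a eta X t @^-1` [set s | A (addition x a (set_val s))])).
  by apply: fin_bigcup_measurable => // x _; exact: measurableI.
apply/seteqP; split => w /=; first by exists (X t w).
by move=> [x _ /= [<-]].
Qed.

End Phase.

(** * Weak limits tested on functions that are deterministic along the process *)

Lemma measurable_continuous_borel (R : realType) (S : ptopologicalType)
    (f : S -> R) :
  continuous f -> measurable_fun [set: borel S] (f : borel S -> R).
Proof.
move=> /continuousP cf.
apply: (measurability _ (RGenOpens.measurableE R)) => _ [_ [u [v ->] <-]].
by rewrite setTI; apply: sub_sigma_algebra; exact/cf/interval_open.
Qed.

Lemma integral_law_cst {R : realType} {d : nat} {L : {fset 'rV[int]_d}}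
    {dT : measure_display} {T : measurableType dT} {P : probability T R}
    {a : R} {eta : set_type (stable R d L)} {X : nat -> T -> L} {t : nat}
    {f : set_type (stable R d L) -> R} {c : R} :
  (forall t (B : set L), measurable (X t @^-1` B)) ->
  continuous f -> (forall w, f (process a eta X t w) = c) ->
  (\int[law P a eta X t]_(s in [set: borel (set_type (stable R d L))])
    (f s)%:E = c%:E)%E.
Proof.
move=> mX cf fc.
pose phi : T -> borel (set_type (stable R d L)) := process a eta X t.
have fphi : (EFin \o f) \o phi = cst c%:E by apply/funext => w /=; rewrite fc.
rewrite /law integral_pushforward //.
- rewrite -/phi fphi preimage_setT integral_cst //.
  by rewrite [X in (_ * X)%E](probability_setT P) mule1.
- by move=> _ A _; rewrite setTI; exact: measurable_process.
- by apply/measurable_EFinP; exact: measurable_continuous_borel.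
- rewrite -/phi fphi preimage_setT.
  exact: finite_measure_integrable_cst.
Qed.

(** The integral of [f] against the law at time [t] is [c t]. Boundedness of [f] makes the limiting
    integral finite, so the convergence holds in [R]. *)
Lemma weak_limit_cvg {R : realType} {d : nat} {L : {fset 'rV[int]_d}}
    {dT : measure_display} {T : measurableType dT} {P : probability T R}
    {a : R} {eta : set_type (stable R d L)} {X : nat -> T -> L}
    {mu : probability (borel (set_type (stable R d L))) R}
    (f : set_type (stable R d L) -> R) {c : nat -> R} :
  (forall t (B : set L), measurable (X t @^-1` B)) ->
  weakly_converges (law P a eta X) mu ->
  continuous f -> bounded_fun f ->
  (forall t w, f (process a eta X t w) = c t) ->
  exists l : R, c @ \oo --> l.
Proof.
move=> mX mu_lim cf bf fc.
exists (fine (\int[mu]_(s in [set: borel (set_type (stable R d L))])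
  (f s)%:E)%E).
have /fineK mu_fin : (\int[mu]_(s in [set: borel (set_type (stable R d L))])
    (f s)%:E)%E \is a fin_num.
  apply: integrable_fin_num => //; apply: measurable_bounded_integrable => //.
    by rewrite [X in (X < _)%E](probability_setT mu) ltry.
  exact: measurable_continuous_borel.
have := mu_lim f cf bf; rewrite -mu_fin => /fine_cvgP[_].
rewrite (_ : _ \o _ = c) //; apply/funext => t /=.
by rewrite (integral_law_cst mX cf (fc t)).
Qed.

(** * Non-convergence of the rotation *)

Theorem theorem2p4 (R : realType) (d : nat) (hd : (0 < d)%N)
    (L : {fset 'rV[int]_d}) (hL : L != fset0)
    (a : R) (ha : 0 <= a < 1)
    (ha' : forall l : nat, (l < 2 * d)%N -> a != l%:R / (2 * d)%:R)
    (dT : measure_display) (T : measurableType dT) (P : probability T R)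
    (X : nat -> T -> L) (hX : iid_uniform P X)
    (eta : set_type (stable R d L)) :
  ~ exists mu : probability (borel (set_type (stable R d L))) R,
      weakly_converges (law P a eta X) mu.
Proof.
move=> [mu mu_lim]; have [mX _ _] := hX; have /andP[a_ge0 a_lt1] := ha.
have D_gt0 : 0 < (2 * d)%:R :> R by rewrite ltr0n muln_gt0.
pose rate := (2 * d)%:R * a.
pose c t := pi *+ 2 * (phase (set_val eta) + rate * t%:R).
have cvg_trig (g : R -> R) : continuous g -> (forall x, `|g x| <= 1) ->
    (forall x y : R, x - y \is a Num.int ->
      g (pi *+ 2 * x) = g (pi *+ 2 * y)) ->
    exists l : R, g \o c @ \oo --> l.
  move=> cg bg gD; apply: (weak_limit_cvg
    (fun s => g (pi *+ 2 * phase (set_val s))) mX mu_lim).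
  - move=> s; apply: continuous_comp; last exact: cg.
    apply: (@cvgM _ _ (nbhs s) (nbhs_filter s) (cst _)); first exact: cvg_cst.
    exact: continuous_phase.
  - exists 1; split; first exact: num_real.
    by move=> M M_gt1 s _ /=; rewrite (le_trans (bg _)) // ltW.
  - by move=> t w; apply: gD; exact: phase_process.
have [A cos_A] := cvg_trig cos (@continuous_cos R) (@cos_max R)
  (fun x y xy => (cos_sin_intD xy).1).
have [B sin_B] := cvg_trig sin (@continuous_sin R) (@sin_max R)
  (fun x y xy => (cos_sin_intD xy).2).
have AB1 : A * A + B * B = 1.
  apply: (cvg_unique _ (cvgD (cvgM cos_A cos_A) (cvgM sin_B sin_B))) => //.
  rewrite (_ : _ + _ = cst 1); first exact: cvg_cst.
  by apply/funext => t; exact: cos2Dsin2.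
(* The cosine of the increment [c t.+1 - c t] does not depend on [t]; by the subtraction formula it
   tends to [A * A + B * B], which is 1. *)
have cos_rate : cos (pi *+ 2 * rate) = 1.
  rewrite -AB1; apply/esym.
  have cos_A' : (cos \o c) t.+1 @[t --> \oo] --> A by rewrite cvg_shiftS.
  have sin_B' : (sin \o c) t.+1 @[t --> \oo] --> B by rewrite cvg_shiftS.
  apply: (cvg_unique _ (cvgD (cvgM cos_A' cos_A) (cvgM sin_B' sin_B))) => //.
  rewrite (_ : _ + _ = cst (cos (pi *+ 2 * rate))); first exact: cvg_cst.
  apply/funext => t; apply: etrans (esym (cosB _ _)) _; congr cos.
  by rewrite /c -natr1; ring.
have rate_nat := cos2pi_eq1 (mulr_ge0 (ltW D_gt0) a_ge0) cos_rate.
(* As [a < 1], the integer [rate] is below [2 * d], hence among the numerators excluded by [ha']. *)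
have rate_lt : (Num.truncn rate < 2 * d)%N.
  by rewrite -(ltr_nat R) -rate_nat gtr_pMr.
by have := ha' _ rate_lt; rewrite -rate_nat mulrAC mulfV ?mul1r ?eqxx ?gt_eqF.
Qed.
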